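(* For $i=1,2$ let $\Sigma_i$ be a signed graph (with marking) on $n_i$ vertices, let $\lambda'_{11},\dots,\lambda'_{1n_1}$ be the eigenvalues of $A(\Sigma_{1\mu})$, and let $R'_{n_2-d},F'_d,P'_{d-1}$ be the polynomials attached to the coronal of $\Sigma_{2\mu}$. Then $\Sigma_1\circledast\Sigma_2$ is an integral signed graph if and only if all roots of $R'_{n_2-d}(x)$ are integers and, for each $i=1,\dots,n_1$, all roots of $xF'_d(x)-n_2\big(\lambda'_{1i}F'_d(x)+P'_{d-1}(x)\big)$ are integers.
   Context: A signed graph is a triple $\Sigma=(S,\sigma,\mu)$ where $S=(V,E)$ is a finite simple undirected graph, $\sigma:E\to\{+1,-1\}$ is a signature and $\mu:V\to\{+1,-1\}$ is a marking. Its adjacency matrix $A(\Sigma)$ has $(i,j)$ entry $\sigma(u_iu_j)$ if $u_i\sim u_j$ and $0$ otherwise; $\Sigma$ is integral if all eigenvalues of $A(\Sigma)$ are integers. The $\mu$-signed graph of $\Sigma$ is $\Sigma_\mu=(S,\sigma_\mu,\mu)$ with $\sigma_\mu(uv)=\mu(u)\mu(v)$. With $\mu(\Sigma)\in\{\pm1\}^n$ the vector of marks, the coronal is $\chi_{A(\Sigma_\mu)}(x)=\mu(\Sigma)^T(xI_n-A(\Sigma_\mu))^{-1}\mu(\Sigma)=p(x)/f(x)$ where $f(x)=\det(xI_n-A(\Sigma_\mu))$ and $p(x)=\mu(\Sigma)^T\mathrm{adj}(xI_n-A(\Sigma_\mu))\mu(\Sigma)$; $R'_{n-d}$ is the monic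 gcd of $p,f$ (degree $n-d$), $F'_d=f/R'_{n-d}$ and $P'_{d-1}=p/R'_{n-d}$. Product $\Sigma_1\circledast\Sigma_2$ ($\Sigma_1$ with vertices $u_1,\dots,u_{n_1}$ and marking $\mu_1$, $\Sigma_2$ with vertices $v_1,\dots,v_{n_2}$ and marking $\mu_2$): vertices $a_{ij},b_{ij}$ ($1\le i\le n_1,1\le j\le n_2$) with $\mu(a_{ij})=\mu_1(u_i)$, $\mu(b_{ij})=\mu_2(v_j)$; edges $a_{ik}a_{jl}$ for all $k,l$ whenever $u_iu_j\in E(\Sigma_1)$, $b_{ri}b_{rj}$ for all $r$ whenever $v_iv_j\in E(\Sigma_2)$, and $a_{ip}b_{iq}$ for all $i,p,q$; every edge $xy$ has sign $\mu(x)\mu(y)$. *)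

(* Defs.v *)
From HB Require Import structures.
From mathcomp Require Import all_boot all_order all_algebra.

Set Implicit Arguments.
Unset Strict Implicit.
Unset Printing Implicit Defensive.

Import Order.TTheory GRing.Theory Num.Theory.
Local Open Scope ring_scope.

Definition is_sign (z : int) : bool := (z == 1) || (z == -1).

Lemma is_signM (a b : int) : is_sign a -> is_sign b -> is_sign (a * b).
Proof. by case/orP=> /eqP-> /orP[] /eqP->. Qed.

(* The signature is a function on edges: the values of [sg u v] at non-adjacent
   pairs carry no meaning and are never used. *)
Record sgraph (V : finType) := SGraph {
  edge : rel V;
  edge_sym : symmetric edge;
  edge_irr : irreflexive edge;
  sg : V -> V -> int;
  sg_sym : forall u v, edge u v -> sg u v = sg v u;
  sg_sign : forall u v, edge u v -> is_sign (sg u v);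
  mark : V -> int;
  mark_sign : forall v, is_sign (mark v)
}.

(* The signed graph with given underlying graph and marking in which every edge
   [uv] has sign [mark u * mark v]. *)
Section MuSigned.
Variables (V : finType) (e : rel V) (m : V -> int).
Hypotheses (e_sym : symmetric e) (e_irr : irreflexive e).
Hypothesis m_sign : forall v, is_sign (m v).

Lemma mu_sg_sym u v : e u v -> m u * m v = m v * m u.
Proof. by move=> _; rewrite mulrC. Qed.

Lemma mu_sg_sign u v : e u v -> is_sign (m u * m v).
Proof. by move=> _; apply: is_signM. Qed.

Definition mu_sgraph : sgraph V :=
  SGraph e_sym e_irr mu_sg_sym mu_sg_sign m_sign.
End MuSigned.

Definition mu_signed (V : finType) (S : sgraph V) : sgraph V :=
  mu_sgraph (@edge_sym V S) (@edge_irr V S) (@mark_sign V S).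

(* In the product, [inl (i, j)] is the vertex a_ij and [inr (i, j)] is b_ij. *)
Section Product.
Variables (V1 V2 : finType) (S1 : sgraph V1) (S2 : sgraph V2).

Definition prod_edge : rel (V1 * V2 + V1 * V2) := fun x y =>
  match x, y with
  | inl (i, _), inl (j, _) => edge S1 i j
  | inr (r, i), inr (s, j) => (r == s) && edge S2 i j
  | inl (i, _), inr (j, _) => i == j
  | inr (i, _), inl (j, _) => i == j
  end.

Definition prod_mark (x : V1 * V2 + V1 * V2) : int :=
  match x with
  | inl (i, _) => mark S1 i
  | inr (_, j) => mark S2 j
  end.

Lemma prod_edge_sym : symmetric prod_edge.
Proof.
move=> [[a b]|[a b]] [[c d]|[c d]] //=; rewrite 1?eq_sym //.
  exact: edge_sym.
by rewrite edge_sym.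
Qed.

Lemma prod_edge_irr : irreflexive prod_edge.
Proof. by move=> [[a b]|[a b]] /=; rewrite ?eqxx edge_irr. Qed.

Lemma prod_mark_sign x : is_sign (prod_mark x).
Proof. by case: x => [[a b]|[a b]]; apply: mark_sign. Qed.

Definition sgraph_prod : sgraph (V1 * V2 + V1 * V2)%type :=
  mu_sgraph prod_edge_sym prod_edge_irr prod_mark_sign.
End Product.

Section Spectra.
Variable C : numClosedFieldType.

(* Rows and columns follow the canonical enumeration of the vertex type. *)
Definition adjm (V : finType) (S : sgraph V) : 'M[C]_#|V| :=
  \matrix_(i, j) if edge S (enum_val i) (enum_val j)
                 then (sg S (enum_val i) (enum_val j))%:~R else 0.

Definition markv (V : finType) (S : sgraph V) : 'cV[C]_#|V| :=
  \col_i (mark S (enum_val i))%:~R.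

Definition is_integer (x : C) : Prop := exists m : int, x = m%:~R.

Definition integral_sgraph (V : finType) (S : sgraph V) : Prop :=
  forall x : C, eigenvalue (adjm S) x -> is_integer x.

Definition all_roots_integer (q : {poly C}) : Prop :=
  forall x : C, root q x -> is_integer x.

(* The coronal of [mu_signed S] is [coronal_p S / coronal_f S]; here
   [char_poly_mx A] is ['X%:M - A] over {poly C}. *)
Definition coronal_f (V : finType) (S : sgraph V) : {poly C} :=
  \det (char_poly_mx (adjm (mu_signed S))).

Definition coronal_p (V : finType) (S : sgraph V) : {poly C} :=
  let m := map_mx polyC (markv S) in
  (m^T *m \adj (char_poly_mx (adjm (mu_signed S))) *m m) 0 0.

(* [gcdp] is only defined up to a unit; [coronal_R] is the monic gcd. *)
Definition coronal_R (V : finType) (S : sgraph V) : {poly C} :=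
  let g := gcdp (coronal_p S) (coronal_f S) in (lead_coef g)^-1 *: g.

Definition coronal_F (V : finType) (S : sgraph V) : {poly C} :=
  coronal_f S %/ coronal_R S.

Definition coronal_P (V : finType) (S : sgraph V) : {poly C} :=
  coronal_p S %/ coronal_R S.

End Spectra.

(* Main.v *)
(** For nonzero [x], an eigenvector of the product is constant along
    [a_i1, ..., a_in2], so after multiplying the [b_ij] entries by [mu1(i)] it
    amounts to a pair [(W, c)] with [W] of size [n1 x n2] and [c] in [C^n1]
    satisfying
      [W (x - A2) = n2 c m2^T]  and  [x c = n2 A1 c + W m2].
    On a [lambda]-eigenvector of [A1] this says that the bordered matrix with
    blocks [x - A2, - m2, - n2 m2^T, x - n2 lambda] is singular.  The
    determinant of that matrix is
      [x f - n2 (lambda f + p) = R * (x F - n2 (lambda F + P))],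
    and [x = 0] is an integer anyway. *)

Require Import Defs.
From HB Require Import structures.
From mathcomp Require Import all_boot all_order all_algebra.
From mathcomp Require Import ring.

Set Implicit Arguments.
Unset Strict Implicit.
Unset Printing Implicit Defensive.

Import Order.TTheory GRing.Theory Num.Theory.
Local Open Scope ring_scope.

(** * Linear algebra: bordered determinants and matrix pencils *)

(** Right multiplication by the block upper triangular [N] clears [u] and leaves
    [c * \det B - v *m \adj B *m u] in the corner; [\det N] is nonzero and cancels. *)
Lemma det_bordered (R : idomainType) (n : nat) (B : 'M[R]_n) (u : 'cV[R]_n)
    (v : 'rV[R]_n) (c : R) :
  \det B != 0 ->
  \det (block_mx B u v c%:M) = c * \det B - (v *m \adj B *m u) 0 0.
Proof.
move=> B_n0.
have adjB_n0 : \det (\adj B) != 0.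
  apply: contraNneq B_n0 => adj0.
  have := det_scalar n (\det B); rewrite -mul_mx_adj det_mulmx adj0 mulr0.
  by move/esym/eqP; rewrite expf_eq0 => /andP[].
pose N := block_mx (\adj B) (- (\adj B *m u)) 0 (\det B)%:M : 'M[R]_(n + 1).
have detN : \det N = \det B * \det (\adj B).
  by rewrite det_ublock det_scalar1 mulrC.
apply: (@mulIf _ (\det N)); first by rewrite detN mulf_neq0.
rewrite -det_mulmx mulmx_block !mulmx0 !addr0.
rewrite !mulmxN mulmxA mul_mx_adj mul_scalar_mx mul_mx_scalar addNr mulmxA.
(* The top left block is now the scalar matrix of [\det B], whose determinant is
   [\det B * \det (\adj B) = \det N]. *)
rewrite det_lblock -mul_mx_adj det_mulmx -detN mulrC; congr (_ * _).
rewrite det_mx11 addrC mxE [X in _ + X]mxE; congr (_ - _).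
by rewrite -scalar_mxM mxE mulr1n.
Qed.

(* If every [K - lambda i *: E] were invertible, [Z] would equal
   [(A - lambda i) Z Q_i] for each [i]; composing over all [i] kills [Z] by
   Cayley-Hamilton. *)
Lemma pencil_det0 (F : fieldType) (n m : nat) (A : 'M[F]_n) (K E : 'M[F]_m)
    (Z : 'M[F]_(n, m)) (lambda : 'I_n -> F) :
  char_poly A = \prod_(i < n) ('X - (lambda i)%:P) ->
  Z *m K = A *m Z *m E -> Z != 0 ->
  exists i, \det (K - lambda i *: E) = 0.
Proof.
move=> charA ZK.
case: n A Z lambda charA ZK => [|n] A Z lambda charA ZK Z_n0.
  by rewrite flatmx0 eqxx in Z_n0.
case: (pickP (fun i => \det (K - lambda i *: E) == 0)) => [i /eqP|reg].
  by exists i.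
have step i : exists Q, Z = (A - (lambda i)%:M) *m Z *m Q.
  exists (E *m invmx (K - lambda i *: E)).
  have uK : K - lambda i *: E \in unitmx by rewrite unitmxE unitfE reg.
  rewrite !mulmxA !mulmxBl mul_scalar_mx -ZK -scalemxAl scalemxAr -mulmxBl -mulmxBr.
  by rewrite mulmxK.
have iter (s : seq 'I_n.+1) : exists Q,
    Z = horner_mx A (\prod_(i <- s) ('X - (lambda i)%:P)) *m Z *m Q.
  elim: s => [|i s [Q ZQ]].
    by exists 1%:M; rewrite big_nil rmorph1 mul1mx mulmx1.
  have [Q' ZQ'] := step i; exists (Q' *m Q).
  rewrite big_cons mulrC rmorphM rmorphB /= horner_mx_X horner_mx_C -mulmxE.
  by rewrite -!mulmxA (mulmxA _ Z) (mulmxA _ Q') -ZQ' mulmxA.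
have [Q] := iter (index_enum 'I_n.+1).
by rewrite -charA Cayley_Hamilton !mul0mx => Z0; rewrite Z0 eqxx in Z_n0.
Qed.

Lemma sum_enum_val (R : nmodType) (V : finType) (F : V -> R) :
  \sum_(i < #|V|) F (enum_val i) = \sum_v F v.
Proof. by rewrite [RHS](reindex (enum_val : 'I_#|V| -> V)) //; apply/onW_bij/enum_val_bij. Qed.

Lemma sum_prodE (R : nmodType) (V1 V2 : finType) (F : V1 * V2 -> R) :
  \sum_p F p = \sum_i \sum_k F (i, k).
Proof. by rewrite pair_bigA; apply: eq_bigr; case. Qed.

(** * Eigenvectors as functions on vertices, and the bordered matrix *)

Section Spectrum.
Variable C : numClosedFieldType.

Definition adjf (V : finType) (S : sgraph V) (u v : V) : C :=
  if edge S u v then (sg S u v)%:~R else 0.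

(** Eigenvectors are rows here, hence the sum over the first index of [adjf]. Functions on vertices
    keep the enumeration of the product's vertices out of later computations. *)
Lemma eigenvalue_adjmP (V : finType) (S : sgraph V) (x : C) :
  reflect (exists2 w : V -> C, (exists v, w v != 0) &
             forall v, \sum_u w u * adjf S u v = x * w v)
          (eigenvalue (adjm C S) x).
Proof.
apply: (iffP (@eigenvalueP _ _ _ _)) => [[r rA r_n0]|[w [v wv_n0] wA]].
  exists (fun v => r 0 (enum_rank v)).
    case/matrix0Pn: r_n0 => i0 [j]; rewrite (ord1 i0) => rj.
    by exists (enum_val j); rewrite enum_valK.
  move=> v; have := congr1 (fun M : 'rV_#|V| => M 0 (enum_rank v)) rA.
  rewrite !mxE => <-; rewrite -[LHS]sum_enum_val; apply: eq_bigr => i _.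
  by rewrite mxE enum_rankK enum_valK.
exists (\row_i w (enum_val i)).
  apply/rowP=> j; rewrite !mxE -wA -[RHS]sum_enum_val.
  by apply: eq_bigr => i _; rewrite !mxE.
apply/matrix0Pn; exists 0, (enum_rank v).
by rewrite mxE enum_rankK.
Qed.

Lemma adjm_mu_signed_sym (V : finType) (S : sgraph V) :
  (adjm C (mu_signed S))^T = adjm C (mu_signed S).
Proof. by apply/matrixP=> i j; rewrite !mxE edge_sym /= mulrC. Qed.

Lemma mark_sqr (V : finType) (S : sgraph V) (v : V) :
  ((mark S v)%:~R * (mark S v)%:~R : C) = 1.
Proof.
by rewrite -intrM; case/orP: (mark_sign S v) => /eqP->.
Qed.

Lemma mark_neq0 (V : finType) (S : sgraph V) (v : V) :
  (mark S v)%:~R != 0 :> C.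
Proof. by rewrite intr_eq0; case/orP: (mark_sign S v) => /eqP->. Qed.

(** Arranged for left null vectors: with adjacency matrix [A], marks [m] and [n = #|V|], a row
    [(b, t)] is null when [b (x - A) = n t m^T] and [b m = t (x - n l)]. *)
Definition bordered (V : finType) (S : sgraph V) (l x : C) : 'M[C]_(#|V| + 1) :=
  block_mx (x%:M - adjm C (mu_signed S)) (- markv C S)
    (- (#|V|%:R *: (markv C S)^T)) (x - #|V|%:R * l)%:M.

(** The determinant is expanded over [{poly C}], where the characteristic matrix has monic, hence
    nonzero, determinant. Evaluating afterwards also covers those [x] that are eigenvalues. *)
Lemma bordered_det (V : finType) (S : sgraph V) (l x : C) :
  \det (bordered S l x) =
  ('X * coronal_f C S
   - #|V|%:R *: (l *: coronal_f C S + coronal_p C S)).[x].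
Proof.
pose m := map_mx polyC (markv C S).
pose n : C := #|V|%:R.
pose N := block_mx (char_poly_mx (adjm C (mu_signed S))) (- m)
   (- (n%:P *: m^T)) ('X - (n * l)%:P)%:M.
have -> : bordered S l x = map_mx (horner_eval x) N.
  rewrite map_block_mx; congr block_mx.
  - apply/matrixP=> i j; rewrite !mxE /= /horner_eval.
    by rewrite hornerD hornerN hornerMn hornerX hornerC.
  - by apply/matrixP=> i j; rewrite !mxE /= /horner_eval hornerN hornerC.
  - apply/matrixP=> i j; rewrite !mxE /= /horner_eval.
    by rewrite hornerN hornerM !hornerC.
  - by rewrite map_scalar_mx /= /horner_eval hornerXsubC.
rewrite det_map_mx /horner_eval /N det_bordered; last first.
  exact: monic_neq0 (char_poly_monic _).
congr (_.[x]).
rewrite mulmxN !mulNmx opprK -!scalemxAl mxE -/(coronal_p C S) -/(coronal_f C S).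
rewrite -!mul_polyC rmorphM /=; ring.
Qed.

(** * Eigenvectors of the product against null vectors of the bordered matrix *)

Section Product.
Variables (V1 V2 : finType) (S1 : sgraph V1) (S2 : sgraph V2).
Implicit Types (w : V1 * V2 + V1 * V2 -> C) (x : C).
Let m1 (i : V1) : C := (mark S1 i)%:~R.
Let m2 (j : V2) : C := (mark S2 j)%:~R.
Let A1 := @adjf V1 (mu_signed S1).
Let A2 := @adjf V2 (mu_signed S2).
Let P := sgraph_prod S1 S2.

(** The vertices [a_jl] with [j] fixed share their signed neighbours, so the right side is free of
    [l]; for a nonzero eigenvalue this makes eigenvectors constant in [l]. *)
Lemma sum_adjf_prod_inl w j l :
  \sum_u w u * adjf P u (inl (j, l)) =
  \sum_i (\sum_k w (inl (i, k))) * A1 i j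
  + m1 j * \sum_q w (inr (j, q)) * m2 q.
Proof.
rewrite big_sumType /=; congr (_ + _).
  rewrite sum_prodE.
  by apply: eq_bigr => i _; rewrite mulr_suml; apply: eq_bigr.
rewrite sum_prodE.
rewrite (bigD1 j) //= [X in _ + X]big1 ?addr0 => [|i /negPf i_j]; last first.
  by apply: big1 => k _; rewrite /adjf /= i_j mulr0.
rewrite mulr_sumr; apply: eq_bigr => q _.
by rewrite /adjf /= eqxx intrM -/(m1 j) -/(m2 q); ring.
Qed.

Lemma sum_adjf_prod_inr w s j :
  \sum_u w u * adjf P u (inr (s, j)) =
  m1 s * m2 j * \sum_k w (inl (s, k)) + \sum_i w (inr (s, i)) * A2 i j.
Proof.
rewrite big_sumType /=; congr (_ + _).
  rewrite sum_prodE.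
  rewrite (bigD1 s) //= [X in _ + X]big1 ?addr0 => [|i /negPf i_s]; last first.
    by apply: big1 => k _; rewrite /adjf /= i_s mulr0.
  rewrite mulr_sumr; apply: eq_bigr => q _.
  by rewrite /adjf /= eqxx intrM -/(m1 s) -/(m2 j); ring.
rewrite sum_prodE.
rewrite (bigD1 s) //= [X in _ + X]big1 ?addr0 => [|i /negPf i_s]; last first.
  by apply: big1 => k _; rewrite /adjf /= i_s mulr0.
by apply: eq_bigr => q _; rewrite /A2 /adjf /= eqxx.
Qed.

(** A left null row [(b, t)] of the bordered matrix is tensored with an eigenvector [y] of [A1]. *)
Lemma bordered_eigenvalue_prod l x :
  x != 0 -> eigenvalue (adjm C (mu_signed S1)) l ->
  \det (bordered S2 l x) = 0 -> eigenvalue (adjm C P) x.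
Proof.
move=> x_n0 /eigenvalue_adjmP[y [v yv_n0] yA] /eqP/det0P[r].
rewrite -[r]hsubmxK; move: (lsubmx r) (rsubmx r) => b t r_n0.
rewrite mul_row_block => /eqP; rewrite row_mx_eq0 => /andP[/eqP bB /eqP bc].
pose t0 := t 0 0; pose bf j := b 0 (enum_rank j).
have eq1 j : \sum_i bf i * A2 i j = x * bf j - #|V2|%:R * t0 * m2 j.
  have := congr1 (fun M : 'rV_#|V2| => M 0 (enum_rank j)) bB.
  rewrite mulmxBr mul_mx_scalar !mxE big_ord1 !mxE enum_rankK -/(bf j) -/t0 -/(m2 j).
  have -> : \sum_j0 b 0 j0 * adjm C (mu_signed S2) j0 (enum_rank j)
    = \sum_i bf i * A2 i j.
    rewrite -[RHS]sum_enum_val; apply: eq_bigr => i _.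
    by rewrite mxE enum_rankK /bf enum_valK.
  by move=> e; apply/oppr_inj/eqP; rewrite -subr_eq0; apply/eqP; rewrite -[RHS]e; ring.
have eq2 : \sum_j bf j * m2 j = t0 * (x - #|V2|%:R * l).
  have := congr1 (fun M : 'rV_1 => M 0 0) bc.
  rewrite mul_mx_scalar !mxE -/t0.
  have -> : \sum_j b 0 j * (- markv C S2) j 0 = - \sum_i bf i * m2 i.
    rewrite -[X in _ = - X]sum_enum_val -sumrN; apply: eq_bigr => i _.
    by rewrite !mxE /bf enum_valK mulrN.
  by move/eqP; rewrite addrC subr_eq0 mulrC => /eqP.
apply/eigenvalue_adjmP.
(* The factor [m1 i] absorbs the mark of [a_ik] in the sign of the edge from [a_ik] to [b_ij], since
   marks square to 1. *)
exists (fun u => match u with inl (i, _) => t0 * y i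
                            | inr (i, j) => m1 i * y i * bf j end); last first.
  case=> [[j k]|[s j]].
    rewrite sum_adjf_prod_inl.
    under eq_bigr => i _ do
      rewrite sumr_const -mulr_natl -mulrA -[t0 * _ * _]mulrA.
    rewrite -!mulr_sumr yA.
    under eq_bigr => q _ do rewrite -mulrA.
    rewrite -mulr_sumr eq2 -[X in m1 j * X]mulrA [m1 j * (m1 j * _)]mulrA mark_sqr.
    by ring.
  rewrite sum_adjf_prod_inr sumr_const -mulr_natl.
  under eq_bigr => i _ do rewrite -mulrA.
  by rewrite -mulr_sumr eq1; ring.
have m1_n0 : m1 v != 0 := mark_neq0 S1 v.
case: (pickP (fun j => bf j != 0)) => [j bj|b0].
  by exists (inr (v, j)); rewrite !mulf_neq0.
have t_n0 : t0 != 0.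
  apply: contraNneq r_n0 => t00; rewrite row_mx_eq0.
  apply/andP; split; apply/eqP/rowP=> j; last by rewrite (ord1 j) mxE.
  by have /negbFE/eqP := b0 (enum_val j); rewrite /bf enum_valK mxE.
(* If [V2] is empty, the product has no vertex to test; [eq2] then reads [0 = t0 * x], a
   contradiction. *)
case: (pickP (mem V2)) => [j _|V20].
  by exists (inl (v, j)); rewrite mulf_neq0.
move: eq2; rewrite big1 => [/esym/eqP|j]; last by have := V20 j.
by rewrite eq_card0 // mul0r subr0 mulf_eq0 (negPf t_n0) (negPf x_n0).
Qed.

(** An eigenvector of the product yields a nonzero [Z] with [Z K = A1 Z E], so [pencil_det0]
    supplies the eigenvalue without diagonalising [A1]. *)
Lemma eigenvalue_prod_bordered (lambda : 'I_#|V1| -> C) x :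
  char_poly (adjm C (mu_signed S1)) = \prod_(i < #|V1|) ('X - (lambda i)%:P) ->
  x != 0 -> eigenvalue (adjm C P) x ->
  exists i, \det (bordered S2 (lambda i) x) = 0.
Proof.
move=> charA x_n0 /eigenvalue_adjmP[w [v wv_n0] wA].
(* The common value of [w] on the [a_ik], read off the eigenvalue equation so that no [k] has to be
   chosen. *)
pose c i := x^-1 * (\sum_i' (\sum_k w (inl (i', k))) * A1 i' i
                    + m1 i * \sum_q w (inr (i, q)) * m2 q).
have wc i k : w (inl (i, k)) = c i.
  by rewrite /c -(sum_adjf_prod_inl w i k) wA mulKf.
have sumc i : \sum_k w (inl (i, k)) = #|V2|%:R * c i.
  by under eq_bigr do rewrite wc; rewrite sumr_const mulr_natl.
pose W : 'M[C]_(#|V1|, #|V2|) :=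
  \matrix_(i, j) (m1 (enum_val i) * w (inr (enum_val i, enum_val j))).
pose c' : 'cV[C]_#|V1| := \col_i c (enum_val i).
(* [K] and [E] separate the dependence on [l]: the bordered matrix is [K - l *: E]. *)
pose K : 'M[C]_(#|V2| + 1) :=
  block_mx (x%:M - adjm C (mu_signed S2)) (- markv C S2)
    (- (#|V2|%:R *: (markv C S2)^T)) x%:M.
pose E : 'M[C]_(#|V2| + 1) := block_mx 0 0 0 (#|V2|%:R)%:M.
have [||i detK] := pencil_det0 (K := K) (E := E) (Z := row_mx W c') charA.
- rewrite mul_mx_row !mul_row_block !mulmx0 !addr0 add0r; congr row_mx.
    apply/matrixP=> i j; rewrite mulmxBr mul_mx_scalar !mxE big_ord1 !mxE.
    under eq_bigr => k _ do rewrite !mxE -mulrA.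
    rewrite -mulr_sumr.
    rewrite (sum_enum_val (fun k => w (inr (enum_val i, k)) * A2 k (enum_val j))).
    have := wA (inr (enum_val i, enum_val j)).
    rewrite sum_adjf_prod_inr sumc => /(canRL (addKr _)) ->.
    rewrite -/(m2 _).
    transitivity ((m1 (enum_val i) * m1 (enum_val i) - 1)
                  * (#|V2|%:R * c (enum_val i) * m2 (enum_val j))); first by ring.
    by rewrite mark_sqr subrr mul0r.
  (* The eigenvalue equation sums over the first index of [A1], the product with [c'] over the
     second; symmetry reconciles them. *)
  rewrite -[adjm C _]adjm_mu_signed_sym; apply/colP=> i.
  rewrite !mul_mx_scalar !mxE.
  under eq_bigr => k _ do rewrite !mxE -mulrA !mulrN.
  rewrite sumrN -mulr_sumr.
  under [X in _ = _ * X]eq_bigr => k _ do rewrite !mxE mulrC.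
  rewrite (sum_enum_val (fun k => w (inr (enum_val i, k)) * m2 k)).
  rewrite (sum_enum_val (fun k => c k * A1 k (enum_val i))).
  rewrite {1}/c mulVKf // [RHS]mulr_sumr -/(m1 _) addrC addrK.
  by apply: eq_bigr => k _; rewrite sumc -(mulrA _ (c k)).
- apply/negP; rewrite row_mx_eq0 => /andP[/eqP W0 /eqP c0].
  move/negP: wv_n0; apply; case: v => [[i k]|[i j]].
    have := congr1 (fun M : 'cV_#|V1| => M (enum_rank i) 0) c0.
    by rewrite !mxE enum_rankK wc => ->; rewrite eqxx.
  have /eqP := congr1 (fun M : 'M_(#|V1|, #|V2|) => M (enum_rank i) (enum_rank j)) W0.
  by rewrite !mxE !enum_rankK mulf_eq0 (negPf (mark_neq0 _ _)).
exists i; rewrite -detK; congr (\det _).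
rewrite /bordered /K /E scale_block_mx !scaler0 opp_block_mx add_block_mx !subr0.
by rewrite scale_scalar_mx -raddfB /= [lambda i * _]mulrC.
Qed.
End Product.

End Spectrum.

(** * Factoring out the gcd, and the equivalence *)

Lemma coronal_f_neq0 (C : numClosedFieldType) (V : finType) (S : sgraph V) :
  coronal_f C S != 0.
Proof. exact: monic_neq0 (char_poly_monic _). Qed.

(** The gcd is nonzero because [coronal_f] is, so its monic multiple still divides both
    polynomials. *)
Lemma coronal_factor (C : numClosedFieldType) (V : finType) (S : sgraph V) :
  coronal_F C S * coronal_R C S = coronal_f C S /\
  coronal_P C S * coronal_R C S = coronal_p C S.
Proof.
have lc_n0 : (lead_coef (gcdp (coronal_p C S) (coronal_f C S)))^-1 != 0.
  by rewrite invr_eq0 lead_coef_eq0 gcdp_eq0 negb_and coronal_f_neq0 orbT.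
by split; apply: divpK; rewrite dvdpZl // ?dvdp_gcdl ?dvdp_gcdr.
Qed.

Theorem theorem7 (C : numClosedFieldType) (V1 V2 : finType)
    (S1 : sgraph V1) (S2 : sgraph V2) (lambda : 'I_#|V1| -> C)
    (V1_nonempty : (0 < #|V1|)%N)
    (lambda_eigenvalues :
       char_poly (adjm C (mu_signed S1)) = \prod_(i < #|V1|) ('X - (lambda i)%:P)) :
  integral_sgraph C (sgraph_prod S1 S2) <->
  (all_roots_integer (coronal_R C S2) /\
   forall i : 'I_#|V1|,
     all_roots_integer
       ('X * coronal_F C S2
        - #|V2|%:R *: (lambda i *: coronal_F C S2 + coronal_P C S2))).
Proof.
have [fE pE] := coronal_factor C S2.
have detE i x : \det (bordered S2 (lambda i) x) =
    ('X * coronal_F C S2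
     - #|V2|%:R *: (lambda i *: coronal_F C S2 + coronal_P C S2)).[x]
    * (coronal_R C S2).[x].
  by rewrite bordered_det -fE -pE -hornerM -!mul_polyC; congr (_.[x]); ring.
have int0 : is_integer (0 : C) by exists 0.
split=> [int_prod|[int_R int_G] x eig_x].
  have int_det i x : \det (bordered S2 (lambda i) x) = 0 -> is_integer x.
    have [->//|x_n0] := eqVneq x 0; move=> det0.
    apply/int_prod/(bordered_eigenvalue_prod x_n0 _ det0).
    rewrite eigenvalue_root_char lambda_eigenvalues (bigD1 i) //=.
    by rewrite rootM root_XsubC eqxx.
  split=> [x /rootP Rx|i x /rootP Gx].
    (* [coronal_R] is a factor of the determinant for every [i], so a single index suffices. *)
    by apply: (int_det (Ordinal V1_nonempty)); rewrite detE Rx mulr0.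
  by apply: (int_det i); rewrite detE Gx mul0r.
have [->//|x_n0] := eqVneq x 0.
have [i /eqP] := eigenvalue_prod_bordered lambda_eigenvalues x_n0 eig_x.
by rewrite detE mulf_eq0 => /orP[Gx|Rx]; [apply: (int_G i)|apply: int_R].
Qed.
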